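(* Let $W\in\mathbb{R}^{N\times N}$ be symmetric, $\mu$ a compactly supported probability measure on $\mathbb{R}$ with free cumulants $(\kappa_i)_{i\ge1}$, and let $(r_t)_{t\ge1},(u_t)_{t\ge1}$ be the iterates generated by the RI-AMP algorithm from an initialization $u_1\in\mathbb{R}^N$. Define $\bar u_1:=u_1$ and $$\bar u_t:=u_t-\left(\langle\partial_1u_t\rangle\, r_1+\cdots+\langle\partial_{t-1}u_t\rangle\, r_{t-1}\right),\qquad\forall t>1.$$ Then, for every $t\ge1$, $$r_s=\sum_{j=1}^{s}\hat P_{s,j}(W)\,\bar u_j,\qquad 1\le s\le t,$$ where the $\hat P_{s,j}$ are polynomials which, collected in the lower triangular matrix $\hat P_t(\lambda):=(\hat P_{s,j}(\lambda))_{1\le s,j\le t}$ (with $\hat P_{s,j}:=0$ for $j>s$), are given by $$\hat P_t(\lambda)=\sum_{i=1}^tQ_i(\lambda)\,\hat\Phi_t^{\,i-1},\qquad\forall\lambda\in\mathbb{R}.$$ Here $(Q_n)_{n\ge0}$ are the polynomials defined by $Q_0(\lambda)=1$ and, with $\Lambda\sim\mu$, $$Q_n(\lambda)=\lambda Q_{n-1}(\lambda)-\sum_{i=1}^n\mathbb{E}[\Lambda Q_{i-1}(\Lambda)]\cdot Q_{n-i}(\lambda),\qquad\forall\lambda\in\mathbb{R},\ n\ge1.$$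
   Context: RI-AMP algorithm: starting from $u_1\in\mathbb{R}^N$, for $t\ge1$, $$r_t=Wu_t-(b_{t,1}u_1+\cdots+b_{t,t}u_t),\qquad u_{t+1}=\eta_{t+1}(r_1,\dots,r_t),$$ where $\eta_{t+1}:\mathbb{R}^t\to\mathbb{R}$ (with partial derivatives) acts separately on the $N$ rows of $(r_1,\dots,r_t)\in\mathbb{R}^{N\times t}$. Write $\langle\partial_iu_j\rangle:=\frac1N\sum_{n=1}^N\partial_i\eta_j(r_1[n],\dots,r_{j-1}[n])$ for $1\le i<j$. $\hat\Phi_t\in\mathbb{R}^{t\times t}$ is the strictly lower triangular matrix with $(j,i)$ entry $\langle\partial_iu_j\rangle$ for $1\le i<j\le t$. The coefficients $b_{t,i}$ are the entries of the last row of the lower triangular matrix $B_t=(b_{s,i})_{1\le i\le s\le t}:=\sum_{i=1}^t\kappa_i\hat\Phi_t^{\,i-1}$, with $\hat\Phi_t^{\,0}:=I_t$ (these are consistent for different $t$). Free cumulants of $\mu$, with moments $m_k=\int x^k\mu(dx)$: the unique sequence with $m_k=\sum_{\pi\in \mathrm{NC}(k)}\prod_{B\in\pi}\kappa_{|B|}$ for all $k\ge1$, $\mathrm{NC}(k)$ being the set of non-crossing partitions of $\{1,\dots,k\}$. For a polynomial $p$, $p(W)$ is the usual matrix polynomial. *)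

(* Defs.v *)
From mathcomp Require Import all_boot all_order all_algebra.
From mathcomp Require Import all_classical all_reals all_analysis.
Import numFieldNormedType.Exports.

Set Implicit Arguments.
Unset Strict Implicit.
Unset Printing Implicit Defensive.

Import Order.TTheory GRing.Theory Num.Theory.
Local Open Scope ring_scope.

(* Families indexed by nat start at index 1 (except Q, which starts at 0), and
   their other values are never used.  Vectors and matrices are indexed by
   ordinals, so i : 'I_t stands for the index i.+1 in {1, ..., t}. *)

Definition compactly_supported (R : realType)
    (mu : probability (measurableTypeR R) R) : Prop :=
  exists2 K : set R, compact K & mu (~` K)%classic = 0%E.

Definition noncrossing (k : nat) (P : {set {set 'I_k}}) : bool :=
  [forall A in P, forall B in P,
     forall a in A, forall c in A, forall b in B, forall d in B,
       [&& (a < b)%N, (b < c)%N & (c < d)%N] ==> (A == B)].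

Definition free_cumulants (R : realType)
    (mu : probability (measurableTypeR R) R) (kappa : nat -> R) : Prop :=
  forall k, (1 <= k)%N ->
    \int[mu]_x (x ^+ k) =
    \sum_(P : {set {set 'I_k}} | finset.partition P (finset.setTfor 'I_k) && noncrossing P)
      \prod_(B in P) kappa #|B|.

Definition Q_polynomials (R : realType)
    (mu : probability (measurableTypeR R) R) (Q : nat -> {poly R}) : Prop :=
  Q 0%N = 1 /\
  forall n, (1 <= n)%N -> forall lambda : R,
    (Q n).[lambda] = lambda * (Q n.-1).[lambda]
      - \sum_(1 <= i < n.+1)
          (\int[mu]_x (x * (Q i.-1).[x])) * (Q (n - i)%N).[lambda].

Section Algorithm.
Variables (R : realType) (N : nat).
Implicit Types (eta : forall j : nat, 'rV[R]_j.-1 -> R) (r u : nat -> 'cV[R]_N).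

Definition unit_row (m i : nat) : 'rV[R]_m := \row_(k < m) (k.+1 == i)%:R.

Definition has_partials (m : nat) (f : 'rV[R]_m -> R) : Prop :=
  forall x i, (1 <= i <= m)%N -> derivable f x (unit_row m i).

Definition partial (m : nat) (i : nat) (f : 'rV[R]_m -> R) (x : 'rV[R]_m) : R :=
  'D_(unit_row m i) f x.

(* Row n of the N x m matrix (r_1, ..., r_m). *)
Definition hist r (m : nat) (n : 'I_N) : 'rV[R]_m := \row_(i < m) r i.+1 n ord0.

(* <d_i u_j>; only meaningful for 1 <= i < j. *)
Definition mean_partial eta r (i j : nat) : R :=
  N%:R^-1 * \sum_(n < N) partial i (@eta j) (hist r j.-1 n).

Definition Phi eta r (t : nat) : 'M[R]_t :=
  \matrix_(j < t, i < t) (if (i < j)%N then mean_partial eta r i.+1 j.+1 else 0).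

Definition Bmx (kappa : nat -> R) eta r (t : nat) : 'M[R]_t :=
  \sum_(1 <= i < t.+1) kappa i *: Phi eta r t ^+ i.-1.

(* The round t of the algorithm, t >= 1, is written with t.+1 in place of t. *)
Definition RI_AMP (W : 'M[R]_N) (kappa : nat -> R) eta (u1 : 'cV[R]_N) r u
    : Prop :=
  [/\ u 1%N = u1,
      forall t, r t.+1 = W *m u t.+1
        - \sum_(i < t.+1) Bmx kappa eta r t.+1 ord_max i *: u i.+1
    & forall t, u t.+2 = \col_(n < N) @eta t.+2 (hist r t.+1 n)].

(* For t = 1 the sum is empty and ubar 1 = u 1. *)
Definition ubar eta r u (t : nat) : 'cV[R]_N :=
  u t - \sum_(1 <= i < t) mean_partial eta r i t *: r i.

End Algorithm.

(* Main.v *)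
(** Let [L] be integration against [mu] and [a_i = L(X Q_(i-1))].  The recurrence
    gives [L(Q_n) = 0] for [n >= 1], and expanding [X^k] through
    [X Q_h = Q_(h+1) + sum_i a_i Q_(h+1-i)] writes [m_k] as a weighted sum over
    Lukasiewicz paths.  Reading a non-crossing partition from left to right with
    a stack of unfinished elements gives the same sum with weights [kappa_i],
    and these sums determine the weights, so [a = kappa].  The algorithm then
    reads [r = (W - B) u], [u = ubar + Phi r] over the commuting [W] and [Phi];
    eliminating [u] yields [r = sum_k Q_(k+1)(W) Phi^k ubar]. *)
From HB Require Import structures.
Require Import Defs.
From mathcomp Require Import all_boot all_order all_algebra.
From mathcomp Require Import all_classical all_reals all_analysis.
From mathcomp Require Import measurable_realfun.
From mathcomp Require Import zify.
Import numFieldNormedType.Exports.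
Import Order.TTheory GRing.Theory Num.Theory.
Local Open Scope ring_scope.

Set Implicit Arguments.
Unset Strict Implicit.
Unset Printing Implicit Defensive.


(* Total weight of the paths from height [h] to height 0 in [k] steps staying
   nonnegative, where a step is either [+1], of weight 1, or [-j], of weight
   [kappa j.+1]. *)
Fixpoint luka_weight (R : comNzRingType) (kappa : nat -> R) (k h : nat) : R :=
  if k is k'.+1 then luka_weight kappa k' h.+1
    + \sum_(j < h.+1) kappa j.+1 * luka_weight kappa k' (h - j)
  else (h == 0%N)%:R.

(** * Non-crossing partitions and Lukasiewicz paths *)

Section NoncrossingPartitions.
Variables (R : comNzRingType) (K : nat) (kappa : nat -> R).
Implicit Types (s l : seq 'I_K) (P : {set {set 'I_K}}) (B : {set 'I_K}).

Notation ord_lt := (fun x y : 'I_K => (x < y)%N).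

Lemma noncrossingP P : reflect
  (forall A B, A \in P -> B \in P -> forall a b c d : 'I_K,
     a \in A -> b \in B -> c \in A -> d \in B ->
     (a < b)%N -> (b < c)%N -> (c < d)%N -> A = B)
  (noncrossing P).
Proof.
apply: (iffP idP) => [ncP A B PA PB a b c d Aa Bb Ac Bd ab bc cd | ncP].
  move: ncP => /forall_inP/(_ A PA)/forall_inP/(_ B PB).
  move=> /forall_inP/(_ a Aa)/forall_inP/(_ c Ac).
  move=> /forall_inP/(_ b Bb)/forall_inP/(_ d Bd).
  by rewrite ab bc cd => /eqP.
apply/forall_inP => A PA; apply/forall_inP => B PB.
apply/forall_inP => a Aa; apply/forall_inP => c Ac.
apply/forall_inP => b Bb; apply/forall_inP => d Bd.
by apply/implyP => /and3P[ab bc cd]; apply/eqP/(ncP A B PA PB a b c d).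
Qed.

(* [s] is the stack, top first, of elements read so far whose block continues
   in [l], the elements still to be read. *)
Definition stack_partition s l P :=
  [&& finset.partition P [set x in s ++ l]%SET, noncrossing P &
      [forall B in P, has (mem B) l]].

Definition top_block c s j : {set 'I_K} := [set x in c :: take j s]%SET.

Lemma stack_partition_nil s P :
  stack_partition s [::] P = (s == [::]) && (P == finset.set0).
Proof.
apply/and3P/andP => [[partP _ /forall_inP noB]|[/eqP-> /eqP->]].
  have P0 : P = finset.set0.
    by apply/eqP; apply: contraT => /set0Pn[B /noB].
  split; last by rewrite P0.
  move: partP; rewrite P0 => /cover_partition; rewrite /finset.cover big_set0 cats0.
  case: s => // x s /setP/(_ x); by rewrite !inE eqxx.
have -> : [set x in [::] ++ [::]]%SET = finset.set0 :> {set 'I_K}.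
  by apply/setP => x; rewrite !inE.
split; first by rewrite partition_set0.
  by apply/noncrossingP => A B; rewrite inE.
by apply/forall_inP => B; rewrite inE.
Qed.

Section Top.
Variables (c : 'I_K) (s l : seq 'I_K).
Hypothesis srt : sorted ord_lt (rev s ++ c :: l).

Let lt_trans : transitive ord_lt.
Proof. by move=> y x z; apply: ltn_trans. Qed.

Let pw : pairwise ord_lt (rev s ++ c :: l).
Proof. by rewrite -sorted_pairwise. Qed.

Lemma stack_lt x : x \in s -> (x < c)%N.
Proof.
move=> xs; move: pw; rewrite pairwise_cat => /and3P[/allrelP h _ _].
by apply: h; rewrite ?mem_rev ?mem_head.
Qed.

Lemma rest_gt x : x \in l -> (c < x)%N.
Proof.
by move=> xl; move: pw; rewrite pairwise_cat /= => /and4P[_ _ /allP/(_ x xl)].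
Qed.

Lemma take_gt_drop j x y : x \in take j s -> y \in drop j s -> (y < x)%N.
Proof.
move=> xs ys; move: pw; rewrite pairwise_cat => /and3P[_ + _].
rewrite -{1}(cat_take_drop j s) rev_cat pairwise_cat => /and3P[/allrelP h _ _].
by apply: h; rewrite mem_rev.
Qed.

Lemma uniq_stack : uniq (rev s ++ c :: l).
Proof. by apply: sorted_uniq srt => // x; rewrite /= ltnn. Qed.

Lemma card_top_block j : (j <= size s)%N -> #|top_block c s j| = j.+1.
Proof.
move=> js; rewrite cardsE.
have /card_uniqP -> : uniq (c :: take j s); last by rewrite /= size_takel.
move: uniq_stack; rewrite cat_uniq rev_uniq => /and3P[us /norP[cs _] _].
rewrite /= take_uniq // andbT; apply: contra cs => /mem_take.
by rewrite -mem_rev.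
Qed.

(** Deeper stack elements precede the whole block and unread ones follow it. Hence closing this
    block creates no crossing. *)
Lemma top_blockI j x y z : x \in drop j s ++ l ->
  y \in top_block c s j -> z \in top_block c s j ->
  ~~ ((y < x) && (x < z))%N.
Proof.
rewrite mem_cat !inE => /orP[xd|xl] yB zB; apply/negP => /andP[yx xz].
  have xy : (x < y)%N.
    case/orP: yB => [/eqP->|]; first by apply/stack_lt/(mem_drop xd).
    by move/take_gt_drop; apply.
  by move: (ltn_trans xy yx); rewrite ltnn.
have zx : (z < x)%N.
  case/orP: zB => [/eqP->|/mem_take/stack_lt zc]; first exact: rest_gt.
  exact: ltn_trans zc (rest_gt xl).
by move: (ltn_trans zx xz); rewrite ltnn.
Qed.

Lemma top_block_disjoint j : [disjoint top_block c s j & [set x in drop j s ++ l]%SET].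
Proof.
rewrite -setI_eq0; apply/set0Pn => -[x]; rewrite !inE mem_cat => /andP[xB].
case/orP => [xd|xl]; case/orP: xB => [/eqP xc|xt].
- by move: (stack_lt (mem_drop xd)); rewrite xc ltnn.
- by move: (take_gt_drop xt xd); rewrite ltnn.
- by move: (rest_gt xl); rewrite xc ltnn.
- by move: (ltn_trans (stack_lt (mem_take xt)) (rest_gt xl)); rewrite ltnn.
Qed.

Lemma top_blockU j :
  top_block c s j :|: [set x in drop j s ++ l]%SET = [set x in s ++ c :: l]%SET.
Proof.
apply/setP => x; rewrite !inE !mem_cat !inE -{3}(cat_take_drop j s) mem_cat.
by do ![case: (_ \in _) | case: (_ == _)].
Qed.

(* A block whose last element is [c] is [c] with an initial segment of the
   stack: a skipped element would belong to a block reaching into [l], which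
   crosses this one. *)
Lemma top_blockP P B : stack_partition s (c :: l) P -> B \in P ->
  ~~ has (mem B) l -> B = top_block c s #|B|.-1 /\ (#|B|.-1 <= size s)%N.
Proof.
move=> /and3P[partP /noncrossingP ncP /forall_inP meetP] PB nBl.
have Bc : c \in B by move: (meetP B PB); rewrite /= (negPf nBl) orbF.
have BD := fintype.subsetP (partitionS partP PB).
have closed x y : x \in B -> y \in s -> (x < y)%N -> y \in B.
  move=> Bx ys xy.
  have : y \in finset.cover P by rewrite (cover_partition partP) inE mem_cat ys.
  case/bigcupP => A PA Ay; have /hasP[z zl Az] := meetP A PA.
  move: zl; rewrite inE => /orP[/eqP zc|zl].
    have tP := partition_trivIset partP.
    by rewrite -(def_pblock tP PB Bc) -zc (def_pblock tP PA Az).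
  by rewrite (ncP B A PB PA x y c z) ?rest_gt ?stack_lt.
(* [j] counts the stack elements above the first one outside [B]; by [closed], nothing deeper lies
   in [B]. *)
pose j := find (predC (mem B)) s.
have js : (j <= size s)%N by apply: find_size.
have -> : B = top_block c s j; last by rewrite card_top_block.
apply/setP => x; rewrite !inE; apply/idP/idP => [Bx|].
  have := BD x Bx; rewrite inE mem_cat inE orbCA => /orP[->//|/orP[xs|xl]]; last first.
    by case/negP: nBl; apply/hasP; exists x.
  move: xs; rewrite -{1}(cat_take_drop j s) mem_cat => /orP[->|xd].
    by rewrite orbT.
  have hs : has (predC (mem B)) s.
    rewrite has_find ltn_neqAle js andbT; apply/negP => /eqP jE.
    by move: xd; rewrite /j jE drop_size.
  have yB := nth_find x hs; rewrite -/j in yB.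
  have jlt : (j < size s)%N by rewrite -has_find.
  have := xd; rewrite (drop_nth x jlt) inE => /orP[/eqP xE|xd'].
    by move: yB; rewrite /= -xE Bx.
  case/negP: yB; apply: (closed x) => //; first exact: mem_nth.
  apply: (take_gt_drop (j := j.+1)) => //.
  by rewrite (take_nth x) // mem_rcons mem_head.
case/orP => [/eqP->//|xt].
have : all (mem B) (take j s).
  by have := has_take_leq (predC (mem B)) js; rewrite ltnn has_predC => /negbFE.
by move/allP; apply.
Qed.

(** Pushing [c] keeps the ground set, so the only new demand is that the block of [c] continue in
    [l]. *)
Lemma stack_partition_pushE P : stack_partition (c :: s) l P =
  stack_partition s (c :: l) P && [forall B in P, has (mem B) l].
Proof.
rewrite /stack_partition (_ : [set x in (c :: s) ++ l]%SET =
  [set x in s ++ c :: l]%SET); last first.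
  by apply/setP => x; rewrite !inE !mem_cat !inE orbCA.
case: finset.partition => //=; case: noncrossing => //=.
apply/idP/andP => [/forall_inP mP|[]//].
split; apply/forall_inP => B /mP //= ->; exact: orbT.
Qed.

(** The bijection behind a pop, in the form in which [reindex_onto] asks for it; the last conjunct
    says that the closed block is not already in [P]. *)
Lemma stack_partition_pop j P : (j <= size s)%N ->
  [&& stack_partition s (c :: l) (top_block c s j |: P)%SET,
      ~~ stack_partition (c :: s) l (top_block c s j |: P)%SET,
      #|finset.pblock (top_block c s j |: P)%SET c|.-1 == j &
      ((top_block c s j |: P) :\ top_block c s j)%SET == P] =
  stack_partition (drop j s) l P.
Proof.
move=> js; set B := top_block c s j.
have Bc : c \in B by rewrite !inE eqxx.
have DB : [set x in s ++ c :: l]%SET :\: B = [set x in drop j s ++ l]%SET.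
  rewrite -(top_blockU j) finset.setDUl finset.setDv finset.set0U.
  by apply/finset.setDidPl; rewrite disjoint_sym top_block_disjoint.
apply/and4P/idP => [[h1 h2 h3 /eqP h4]|h].
  have PB : B \in (B |: P)%SET by rewrite setU11.
  have := h1 => /and3P[partP /noncrossingP ncP /forall_inP mP].
  have tP := partition_trivIset partP.
  rewrite -h4; apply/and3P; split.
  - by rewrite -DB; apply: partitionD1.
  - apply/noncrossingP => A A' /setD1P[_ PA] /setD1P[_ PA']; exact: ncP.
  - apply/forall_inP => A /setD1P[AB PA].
    have := mP A PA; rewrite /= => /orP[Ac|//].
    by case/eqP: AB; rewrite -(def_pblock tP PA Ac) (def_pblock tP PB Bc).
case/and3P: h => partP /noncrossingP ncP /forall_inP mP.
have nBP : B \notin P.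
  apply/negP => /(partitionS partP)/fintype.subsetP/(_ c Bc) cD.
  by have /disjointFr/(_ Bc) := top_block_disjoint j; rewrite cD.
have partBP : finset.partition (B |: P)%SET [set x in s ++ c :: l]%SET.
  rewrite -(top_blockU j); apply: partitionU1 => //.
    by apply/set0Pn; exists c.
  exact: top_block_disjoint.
have nBl : ~~ has (mem B) l.
  apply/hasP => -[x xl Bx].
  by have /disjointFr/(_ Bx) := top_block_disjoint j; rewrite inE mem_cat xl orbT.
have PD A x : A \in P -> x \in A -> x \in drop j s ++ l.
  by move=> PA Ax; have /fintype.subsetP/(_ x Ax) := partitionS partP PA; rewrite inE.
split.
- apply/and3P; split=> //.
    apply/noncrossingP => A A' /setU1P[->|PA] /setU1P[->|PA'] //.
    + move=> a b x d Ba A'b Bx A'd ab bx xd.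
      by have := top_blockI (PD _ _ PA' A'b) Ba Bx; rewrite ab bx.
    + move=> a b x d Aa Bb Ax Bd ab bx xd.
      by have := top_blockI (PD _ _ PA Ax) Bb Bd; rewrite bx xd.
    + exact: ncP.
  apply/forall_inP => A /setU1P[->|/mP /= ->]; last by rewrite orbT.
  by rewrite /= Bc.
- apply/negP => /and3P[_ _ /forall_inP/(_ B)].
  by rewrite setU11 (negPf nBl) => /(_ isT).
- rewrite (def_pblock (partition_trivIset partBP) _ Bc) ?setU11 //.
  by rewrite card_top_block.
- by rewrite setU1K.
Qed.

End Top.

(** The stack size is the height of the path. Reading [c] either pushes it, an up step, or closes
    its block with [j] stack elements, a step [-j] of weight [kappa j.+1]. *)
Lemma sum_stack_partition s l : sorted ord_lt (rev s ++ l) ->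
  \sum_(P | stack_partition s l P) \prod_(B in P) kappa #|B| =
  luka_weight kappa (size l) (size s).
Proof.
elim: l s => [|c l IHl] s srt /=.
  rewrite (eq_bigl _ _ (stack_partition_nil s)).
  case: s {srt} => [|x s] /=; last by rewrite big_pred0.
  by rewrite big_pred1_eq big_set0.
(* If [c] is not pushed, some block misses [l]; it ends at [c], so it is the block of [c] and
   [top_blockP] gives its shape. *)
have popP P : stack_partition s (c :: l) P -> ~~ stack_partition (c :: s) l P ->
    [/\ finset.pblock P c \in P,
        finset.pblock P c = top_block c s #|finset.pblock P c|.-1 &
        (#|finset.pblock P c|.-1 <= size s)%N].
  move=> h; rewrite stack_partition_pushE h /= negb_forall_in => /exists_inP[B PB nBl].
  have [BE Bs] := top_blockP srt h PB nBl.
  have /and3P[partP _ _] := h.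
  by rewrite (def_pblock (partition_trivIset partP) PB) // BE !inE eqxx.
rewrite (bigID (stack_partition (c :: s) l)) /=; congr (_ + _).
  rewrite -(IHl (c :: s)) /=; last by rewrite rev_cons cat_rcons.
  apply: eq_bigl => P; rewrite stack_partition_pushE andbA; congr (_ && _).
  exact: andbb.
(* Pops are sorted by the number of stack elements removed; the bound in [popP] ensures that [inord]
   keeps this number. *)
rewrite (partition_big (fun P => inord #|finset.pblock P c|.-1 : 'I_(size s).+1)
  predT) //=.
apply: eq_bigr => j _; have js : (j <= size s)%N by rewrite -ltnS.
rewrite (reindex_onto (fun P => top_block c s j |: P)%SET
  (fun P => P :\ top_block c s j)%SET); last first.
  move=> P /andP[/andP[h1 h2] /eqP <-]; have [PB BE Bs] := popP P h1 h2.
  by rewrite inordK ?ltnS // -BE finset.setD1K.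
rewrite -size_drop -IHl; last first.
  apply: subseq_sorted srt; first by move=> y x z; apply: ltn_trans.
  apply: (cat_subseq _ (subseq_cons l c)).
  by rewrite subseq_rev drop_subseq.
rewrite big_distrr /=; apply: eq_big => [P|P].
  rewrite -(stack_partition_pop srt) //.
  apply/andP/and4P => [[/andP[/andP[h1 h2] h3] h4]|[h1 h2 h3 h4]].
    split=> //; have [_ _ Bs] := popP _ h1 h2.
    by move/eqP/(congr1 val): h3; rewrite /= inordK ?ltnS // => /eqP.
  by split=> //; rewrite h1 h2 (eqP h3) inord_val eqxx.
move=> /andP[_ /eqP nBP]; rewrite big_setU1 /=; first by rewrite (card_top_block srt).
by rewrite -nBP !inE eqxx.
Qed.

End NoncrossingPartitions.

(** Reading starts with an empty stack, where meeting the unread elements just means being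
    nonempty. *)
Lemma sum_noncrossing (R : comNzRingType) (kappa : nat -> R) k :
  \sum_(P : {set {set 'I_k}} |
      finset.partition P (finset.setTfor 'I_k) && noncrossing P)
    \prod_(B in P) kappa #|B| = luka_weight kappa k 0.
Proof.
have srt : sorted (fun x y : 'I_k => (x < y)%N) (rev [::] ++ enum 'I_k).
  by rewrite -(sorted_map (e' := ltn)) val_enum_ord iota_ltn_sorted.
rewrite -[k in RHS]size_enum_ord -(sum_stack_partition kappa srt).
apply: eq_bigl => P; rewrite /stack_partition.
rewrite (_ : [set x in _]%SET = finset.setTfor 'I_k); last first.
  by apply/setP => x; rewrite !inE mem_enum.
case partP: finset.partition => //=; case: noncrossing => //=.
apply/esym/forall_inP => B PB.
have /set0Pn[x Bx] := partition_neq0 partP PB.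
by apply/hasP; exists x; rewrite ?mem_enum.
Qed.

(** * Moments as path weights, and recovery of the weights *)

Section FunctionalRecurrence.
Variables (R : comNzRingType).

(** A weight [kappa n] needs a drop from height [n - 1]. When [k + h = n], only the path that climbs
    [k - 1] times and then falls to 0 has one, so [kappa n] enters with coefficient 1. *)
Lemma luka_weight_leading (kappa kappa' : nat -> R) n :
  (forall i, (0 < i < n)%N -> kappa i = kappa' i) ->
  forall k h,
    ((k + h < n)%N -> luka_weight kappa k h = luka_weight kappa' k h) /\
    ((0 < k)%N -> (k + h)%N = n ->
       luka_weight kappa k h - kappa n = luka_weight kappa' k h - kappa' n).
Proof.
move=> eqk; elim=> [|k IHk] h //=; split=> [khn|_ khn].
  rewrite (IHk _).1; last by lia.
  congr (_ + _); apply: eq_bigr => j _; have jh := ltn_ord j.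
  by rewrite eqk ?(IHk _).1 //; lia.
have low j : (j < h.+1)%N -> luka_weight kappa k (h - j) = luka_weight kappa' k (h - j).
  by move=> jh; apply: (IHk _).1; lia.
case: k IHk khn low => [|k] IHk khn low.
  (* With one step left, only the full drop [j = h] reaches 0. *)
  rewrite /= !add0r !big_ord_recr /= subnn eqxx !mulr1.
  have -> : h.+1 = n by lia.
  rewrite !addrK; apply: eq_bigr => j _.
  have jh := ltn_ord j; rewrite (_ : (h - j == 0)%N = false) ?mulr0 //; lia.
rewrite [LHS]addrAC [RHS]addrAC (IHk _).2 //; last by lia.
congr (_ + _); apply: eq_bigr => j _; rewrite low // eqk //.
by have := ltn_ord j; lia.
Qed.

Lemma luka_weight_inj (kappa kappa' : nat -> R) :
  (forall k, (0 < k)%N -> luka_weight kappa k 0 = luka_weight kappa' k 0) ->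
  forall i, (0 < i)%N -> kappa i = kappa' i.
Proof.
move=> eqF; elim/ltn_ind => i IHi i0.
have eqk j : (0 < j < i)%N -> kappa j = kappa' j.
  by move=> /andP[j0 ji]; apply: IHi.
have := (luka_weight_leading eqk i 0).2 i0 (addn0 i).
by rewrite eqF // => /addrI/oppr_inj.
Qed.

Variables (L : {scalar {poly R}}) (Q : nat -> {poly R}).
Let a i := L ('X * Q i.-1).
Hypothesis L1 : L 1 = 1.
Hypothesis Q0 : Q 0%N = 1.
Hypothesis QS : forall n,
  Q n.+1 = 'X * Q n - \sum_(i < n.+1) a i.+1 *: Q (n - i)%N.

(** The last term of the recurrence, [L('X * Q n) *: Q 0], cancels ['X * Q n] under [L]; the others
    vanish by induction. *)
Lemma functional_Q n : L (Q n) = (n == 0%N)%:R.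
Proof.
elim/ltn_ind: n => -[|n] IHn; first by rewrite Q0 L1.
rewrite QS linearB linear_sum big_ord_recr /= subnn linearZ /= IHn // mulr1.
rewrite big1 ?add0r ?subrr // => i _; rewrite linearZ /= IHn; last by lia.
by have := ltn_ord i; case: eqP => [|_ _]; rewrite ?mulr0 //; lia.
Qed.

Lemma functional_XnQ k h : L ('X^k * Q h) = luka_weight a k h.
Proof.
elim: k h => [|k IHk] h; first by rewrite mul1r functional_Q.
have XQ : 'X * Q h = Q h.+1 + \sum_(i < h.+1) a i.+1 *: Q (h - i)%N.
  by rewrite QS subrK.
rewrite exprSr -mulrA XQ mulrDr linearD IHk mulr_sumr linear_sum /=.
by congr (_ + _); apply: eq_bigr => i _; rewrite -scalerAr linearZ /= IHk.
Qed.

End FunctionalRecurrence.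

(** * Strictly lower triangular recursions *)

Lemma sum_ord_trunc (V : nmodType) (m t : nat) (F : nat -> V) :
  (m <= t)%N -> (forall k, (m <= k)%N -> F k = 0) ->
  \sum_(k < t) F k = \sum_(k < m) F k.
Proof.
move=> mt F0; rewrite (big_ord_widen t F mt) [RHS]big_mkcond.
by apply: eq_bigr => k _; case: ltnP => // /F0.
Qed.

(** Cauchy product regrouping, used to collect a product of two series in [phi] by total power. *)
Lemma sum_triangle (V : nmodType) (t : nat) (G : nat -> nat -> V) :
  (forall k l, (t <= k + l)%N -> G k l = 0) ->
  \sum_(k < t) \sum_(l < t) G k l = \sum_(n < t) \sum_(i < n.+1) G i (n - i)%N.
Proof.
move=> G0.
under [RHS]eq_bigr => n _ do rewrite (big_ord_widen t (fun i => G i (n - i)%N)) //.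
rewrite [RHS](exchange_big_dep predT) //=; apply: eq_bigr => i _.
rewrite (sum_ord_trunc (m := t - i) (F := G i)) ?leq_subr // => [|k ki]; last by apply: G0; lia.
transitivity (\sum_(i <= n < t) G i (n - i)%N); last first.
  by rewrite (big_nat_widenl i 0) // big_mkord.
have := big_addn 0 t i predT (fun n => G i (n - i)%N).
rewrite add0n => ->; rewrite big_mkord.
by apply: eq_bigr => l _; rewrite addnK.
Qed.

Section StrictlyLowerTriangular.
Variables (R : comNzRingType) (phi : nat -> nat -> R).

(* Entries of the powers of the infinite strictly lower triangular matrix with
   entries [phi s i], [i < s]; indices start at 0. *)
Fixpoint tri_pow (k s j : nat) : R :=
  if k is k'.+1 then \sum_(i < s) phi s i * tri_pow k' i j else (s == j)%:R.

(** Each factor [phi] lowers the index by at least one; this makes every series in [phi] finite on a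
    given row. *)
Lemma tri_pow_eq0 k s j : (s < k + j)%N -> tri_pow k s j = 0.
Proof.
elim: k s => [|k IHk] s /=; first by move=> sj; rewrite ltn_eqF.
move=> skj; rewrite big1 // => i _; rewrite IHk ?mulr0 //.
by have := ltn_ord i; lia.
Qed.

Variable N : nat.
Implicit Types (f : nat -> 'cV[R]_N.+1) (A : nat -> 'M[R]_N.+1).

(** Row [s] of the [k]-th power applied to the sequence [f]; stopping at [j = s] loses nothing by
    triangularity. *)
Definition tri_act k f s : 'cV[R]_N.+1 := \sum_(j < s.+1) tri_pow k s j *: f j.

Lemma tri_act0 f s : tri_act 0 f s = f s.
Proof.
rewrite /tri_act big_ord_recr /= eqxx scale1r big1 ?add0r // => j _.
by rewrite gtn_eqF ?scale0r.
Qed.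

Lemma tri_actS k f s : tri_act k.+1 f s = \sum_(i < s) phi s i *: tri_act k f i.
Proof.
rewrite /tri_act /= (sum_ord_trunc (m := s)
  (F := fun j => (\sum_(i < s) phi s i * tri_pow k i j) *: f j)) //; last first.
  move=> j sj; rewrite big1 ?scale0r // => i _; rewrite tri_pow_eq0 ?mulr0 //.
  by have := ltn_ord i; lia.
under [LHS]eq_bigr => j _ do rewrite scaler_suml.
rewrite exchange_big /=; apply: eq_bigr => i _; rewrite scaler_sumr.
rewrite -(sum_ord_trunc (t := s) (m := i.+1)
  (F := fun j => phi s i *: (tri_pow k i j *: f j))) //; last first.
  by move=> j ij; rewrite tri_pow_eq0 ?scale0r ?scaler0 //; lia.
by apply: eq_bigr => j _; rewrite scalerA.
Qed.

Lemma tri_act_eq0 k f s : (s < k)%N -> tri_act k f s = 0.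
Proof.
move=> sk; rewrite /tri_act big1 // => j _.
by rewrite tri_pow_eq0 ?scale0r //; lia.
Qed.

Lemma tri_act_add k l f s : tri_act k (tri_act l f) s = tri_act (k + l) f s.
Proof.
elim: k s => [|k IHk] s; first by rewrite tri_act0.
by rewrite addSn !tri_actS; apply: eq_bigr => i _; rewrite IHk.
Qed.

Lemma tri_act_sum k (t : nat) A (g : nat -> nat -> 'cV[R]_N.+1) s :
  tri_act k (fun i => \sum_(l < t) A l *m g l i) s =
  \sum_(l < t) A l *m tri_act k (g l) s.
Proof.
rewrite /tri_act; under eq_bigr do rewrite scaler_sumr.
rewrite exchange_big /=; apply: eq_bigr => l _.
by rewrite mulmx_sumr; apply: eq_bigr => j _; rewrite scalemxAr.
Qed.

Lemma eq_tri_act k f g s : (forall i, (i <= s)%N -> f i = g i) ->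
  tri_act k f s = tri_act k g s.
Proof. by move=> fg; apply: eq_bigr => j _; rewrite fg // -ltnS. Qed.

(* In matrix form, [r = W u - B u] and [u = v + Phi r], whose solution is
   [u = Q(Phi) v] for the generating function [Q] of the [q k]. *)
Lemma tri_solution (kappa : nat -> R) (W : 'M[R]_N.+1) (q : nat -> 'M[R]_N.+1)
    (r u v : nat -> 'cV[R]_N.+1) :
  q 0%N = 1 ->
  (forall k, q k.+1 = W * q k - \sum_(i < k.+1) kappa i.+1 *: q (k - i)%N) ->
  (forall s, r s = W *m u s - \sum_(k < s.+1) kappa k.+1 *: tri_act k u s) ->
  (forall s, u s = v s + \sum_(i < s) phi s i *: r i) ->
  forall s, r s = \sum_(k < s.+1) q k.+1 *m tri_act k v s.
Proof.
move=> q0 qS rE uE; elim/ltn_ind => s IHs.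
(* [u i] involves only [r j] with [j < i], so the induction hypothesis applies. The common range
   [s.+1] allows substitution into every [tri_act k u s]. *)
have uQ i : (i <= s)%N -> u i = \sum_(k < s.+1) q k *m tri_act k v i.
  move=> is_; rewrite (sum_ord_trunc (m := i.+1)
    (F := fun k => q k *m tri_act k v i)) //; last first.
    by move=> k ik; rewrite tri_act_eq0 ?mulmx0.
  rewrite big_ord_recl /= q0 mul1mx tri_act0 uE; congr (_ + _).
  under [RHS]eq_bigr do rewrite tri_actS mulmx_sumr.
  rewrite exchange_big /=; apply: eq_bigr => j _.
  rewrite IHs ?(leq_trans (ltn_ord j)) // scaler_sumr.
  rewrite -(sum_ord_trunc (t := i) (m := j.+1)
    (F := fun k => phi i j *: (q k.+1 *m tri_act k v j))) //; last first.
    by move=> k jk; rewrite tri_act_eq0 ?mulmx0 ?scaler0.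
  by apply: eq_bigr => k _; rewrite scalemxAr.
rewrite rE uQ //.
have -> : \sum_(k < s.+1) kappa k.+1 *: tri_act k u s =
    \sum_(k < s.+1) \sum_(l < s.+1)
      kappa k.+1 *: (q l *m tri_act (k + l) v s).
  apply: eq_bigr => k _; rewrite (eq_tri_act _ uQ).
  rewrite (tri_act_sum k s.+1 q (fun l => tri_act l v)) scaler_sumr.
  by apply: eq_bigr => l _; rewrite tri_act_add.
rewrite (sum_triangle (G := fun k l => kappa k.+1 *: (q l *m tri_act (k + l) v s)));
  last by move=> k l skl; rewrite tri_act_eq0 ?mulmx0 ?scaler0.
(* The coefficient of the [k]-th power is [W * q k] minus the convolution of [kappa] and [q], that
   is, [q k.+1]. *)
rewrite mulmx_sumr -sumrB; apply: eq_bigr => k _.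
rewrite qS mulmxBl -mulmxA mulmx_suml; congr (_ - _); apply: eq_bigr => i _.
by rewrite subnKC ?scalemxAl // -ltnS.
Qed.

End StrictlyLowerTriangular.

(** * Integration of polynomials against [mu] *)

Section Moments.
Variables (R : realType) (mu : probability (measurableTypeR R) R).

(** A continuous function is bounded on the compact set carrying the finite measure [mu]. *)
Lemma compactly_supported_integrable (f : R -> R) :
  compactly_supported mu -> continuous f -> mu.-integrable setT (EFin \o f).
Proof.
move=> [K cK muK0] cf.
have mf : measurable_fun setT f by apply: continuous_measurable_fun.
have mK : measurable K by apply: compact_measurable.
have mEf : measurable_fun setT (EFin \o f) by exact/measurable_EFinP.
refine ((negligible_integrable (mu := mu)
  (measurableC mK) measurableT mEf muK0).2 _).
rewrite setTD setCK; apply: measurable_bounded_integrable => //.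
- exact: le_lt_trans (probability_le1 mu mK) (ltry 1).
- exact: measurable_funS mf.
have := compact_bounded (continuous_compact (continuous_subspaceT cf) cK).
move=> [M [Mr hM]]; exists M; split=> // x Mx y Ky.
by apply: (hM x Mx); exists y.
Qed.

Lemma moment_functional : compactly_supported mu ->
  {L : {scalar {poly R}} | forall p : {poly R}, L p = \int[mu]_x p.[x]}.
Proof.
move=> hmu; pose E (p : {poly R}) : R := \int[mu]_x p.[x].
have lE : scalar E.
  move=> a p q; rewrite /E /= -RintegralZl //; last first.
    by apply: compactly_supported_integrable => //; apply: continuous_horner.
  rewrite -RintegralD //; last 2 first.
  - apply: compactly_supported_integrable => //.
    by move=> x; apply: cvgMr; apply: continuous_horner.
  - by apply: compactly_supported_integrable => //; apply: continuous_horner.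
  by apply: eq_Rintegral => x _; rewrite hornerD hornerZ.
pose L := GRing.isLinear.Build R {poly R} R *%R E lE.
pose L' : {scalar {poly R}} := HB.pack E L.
by exists L'.
Qed.

End Moments.

(** The naturals below the size of [p - q] are distinct and would be too many roots. This turns the
    pointwise recurrence of [Q] into a polynomial identity. *)
Lemma horner_ext (R : numDomainType) (p q : {poly R}) :
  (forall x, p.[x] = q.[x]) -> p = q.
Proof.
move=> pq; apply/eqP; rewrite -subr_eq0; apply/eqP.
apply: (roots_geq_poly_eq0 (rs := [seq i%:R | i <- iota 0 (size (p - q)%R)])).
- by apply/allP => x _; rewrite rootE !hornerE pq subrr.
- by rewrite map_inj_uniq ?iota_uniq //; apply: mulrIn; rewrite oner_eq0.
- by rewrite size_map size_iota.
Qed.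

(** * Powers of [Phi] and the coefficients of the algorithm *)

Section PhiPowers.
Variables (R : realType) (N : nat) (eta : forall j : nat, 'rV[R]_j.-1 -> R).
Variable r : nat -> 'cV[R]_N.
Let phi s i := mean_partial eta r i.+1 s.+1.

(** By triangularity, truncation to size [t] commutes with powers, so the entries are consistent for
    different [t]. *)
Lemma Phi_expE t k (s j : 'I_t) : (Phi eta r t ^+ k) s j = tri_pow phi k s j.
Proof.
elim: k s => [|k IHk] s; first by rewrite expr0 mxE.
pose F i := if (i < s)%N then phi s i * tri_pow phi k i j else 0.
rewrite exprS mxE; transitivity (\sum_(i < t) F i).
  by apply: eq_bigr => i _; rewrite mxE IHk /F; case: ifP => _; rewrite ?mul0r.
rewrite (sum_ord_trunc (m := s) (F := F)) 1?ltnW // => [|i si].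
  by apply: eq_bigr => i _; rewrite /F ltn_ord.
by rewrite /F ltnNge si.
Qed.

Lemma Bmx_last (kappa : nat -> R) s (i : 'I_s.+1) :
  Bmx kappa eta r s.+1 ord_max i =
  \sum_(k < s.+1) kappa k.+1 * tri_pow phi k s i.
Proof.
rewrite /Bmx big_add1 big_mkord summxE.
by apply: eq_bigr => k _; rewrite mxE Phi_expE.
Qed.

End PhiPowers.

Theorem lemma3 (R : realType) (n : nat) (W : 'M[R]_n.+1)
    (mu : probability (measurableTypeR R) R) (kappa : nat -> R)
    (eta : forall j : nat, 'rV[R]_j.-1 -> R)
    (u1 : 'cV[R]_n.+1) (r u : nat -> 'cV[R]_n.+1) (Q : nat -> {poly R})
    (hW : W^T = W)
    (hmu : compactly_supported mu)
    (hkappa : free_cumulants mu kappa)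
    (heta : forall j : nat, (2 <= j)%N -> has_partials (eta j))
    (hru : RI_AMP W kappa eta u1 r u)
    (hQ : Q_polynomials mu Q) :
  exists P : nat -> nat -> {poly R},
    (forall s j : nat, (s < j)%N -> P s j = 0) /\
    forall t : nat, (1 <= t)%N ->
      (forall lambda : R,
         \matrix_(s < t, j < t) (P s.+1 j.+1).[lambda] =
         \sum_(1 <= i < t.+1) (Q i).[lambda] *: Phi eta r t ^+ i.-1) /\
      (forall s : nat, (1 <= s <= t)%N ->
         r s = \sum_(1 <= j < s.+1) horner_mx W (P s j) *m ubar eta r u j).
Proof.
have [_ rE _] := hru; have [Q0 QE] := hQ.
have [L LE] := moment_functional hmu.
pose a i := L ('X * Q i.-1).
have QSa m : Q m.+1 = 'X * Q m - \sum_(i < m.+1) a i.+1 *: Q (m - i)%N.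
  apply: horner_ext => x.
  rewrite hornerD hornerN hornerM hornerX horner_sum QE // big_add1 big_mkord.
  congr (_ - _); apply: eq_bigr => i _; rewrite hornerZ /a LE subSS /=.
  by congr (_ * _); apply: eq_Rintegral => y _; rewrite hornerM hornerX.
have L1 : L 1 = 1.
  transitivity (\int[mu]_x (1 : R)).
    by rewrite LE; apply: eq_Rintegral => x _; rewrite hornerC.
  rewrite Rintegral_cst // mul1r; exact: (congr1 fine (probability_setT mu)).
(* Both sequences give the moments of [mu] as path weights from height 0: [a] through [Q 0 = 1],
   [kappa] through non-crossing partitions. *)
have aE i : (0 < i)%N -> a i = kappa i.
  move: i; apply: luka_weight_inj => k k0.
  rewrite -(functional_XnQ L1 Q0 QSa) -sum_noncrossing -hkappa // Q0 mulr1 LE.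
  by apply: eq_Rintegral => x _; rewrite hornerXn.
have QS m : Q m.+1 = 'X * Q m - \sum_(i < m.+1) kappa i.+1 *: Q (m - i)%N.
  by rewrite QSa; congr (_ - _); apply: eq_bigr => i _; rewrite aE.
pose phi s i := mean_partial eta r i.+1 s.+1.
have sol s : r s.+1 = \sum_(k < s.+1)
    horner_mx W (Q k.+1) *m tri_act phi k (fun i => ubar eta r u i.+1) s.
  apply: (@tri_solution _ phi _ kappa W (fun k => horner_mx W (Q k))
    (fun i => r i.+1) (fun i => u i.+1)) => {s} [|k|s|s].
  - by rewrite Q0 rmorph1.
  - rewrite QS rmorphB rmorphM /= horner_mx_X rmorph_sum /=.
    by congr (_ - _); apply: eq_bigr => i _; rewrite horner_mxZ.
  - rewrite rE; congr (_ - _).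
    under eq_bigr do rewrite Bmx_last scaler_suml.
    rewrite exchange_big /=; apply: eq_bigr => k _; rewrite scaler_sumr.
    by apply: eq_bigr => i _; rewrite scalerA.
  - by rewrite /ubar big_add1 big_mkord subrK.
(* The entry of the claimed matrix, free of [t]: row [s] only sees powers below [s], and the
   predecessors pass from indices starting at 1 to indices starting at 0. *)
pose P s j := if (s < j)%N then 0
  else \sum_(k < s) tri_pow phi k s.-1 j.-1 *: Q k.+1.
have PE s j : P s.+1 j.+1 = \sum_(k < s.+1) tri_pow phi k s j *: Q k.+1.
  rewrite /P; case: ltnP => // sj; rewrite big1 // => k _.
  by rewrite tri_pow_eq0 ?scale0r //; lia.
exists P; split=> [s j sj|t t0]; first by rewrite /P sj.
split=> [x|[|s]] // => [|/andP[_ st]].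
  apply/matrixP => s j; rewrite mxE PE horner_sum big_add1 big_mkord summxE.
  rewrite -(sum_ord_trunc (t := t) (m := s.+1)
    (F := fun k => (tri_pow phi k s j *: Q k.+1).[x])) //; last first.
    by move=> k sk; rewrite tri_pow_eq0 ?scale0r ?horner0 //; lia.
  by apply: eq_bigr => k _; rewrite mxE Phi_expE hornerZ mulrC.
rewrite sol big_add1 big_mkord /=.
under [RHS]eq_bigr do rewrite PE rmorph_sum mulmx_suml.
rewrite exchange_big /=; apply: eq_bigr => k _; rewrite mulmx_sumr.
by apply: eq_bigr => j _; rewrite horner_mxZ -scalemxAl scalemxAr.
Qed.
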